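(* Let $\mathfrak g$ be a finite-dimensional real Lie algebra and let $\Gamma$ be a finite group acting faithfully and linearly on $\mathfrak g$ preserving its Lie bracket. Let $V=\mathfrak g^*$ and let $\pi\in V^*\otimes\wedge^2V$ be the linear Poisson structure given by the Lie bracket. For $\gamma\in\Gamma$ with $l(\gamma)=2$, let $\pi_\gamma$ be the projection of $\pi$ onto the component $(V^\gamma)^*\otimes\wedge^2N^\gamma$. Let $(c_\gamma)_{l(\gamma)=2}$ be real constants with $c_{\alpha\gamma\alpha^{-1}}=c_\gamma$ for all $\alpha\in\Gamma$. Then the collection $$\Pi=\pi+\sum_{\gamma\in\Gamma,\ l(\gamma)=2}c_\gamma\pi_\gamma$$ (with $\pi$ placed at the identity component and $c_\gamma\pi_\gamma$ at the $\gamma$-component) defines a linear Poisson structure on $S(V^* )\rtimes\Gamma$.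
   Context: Fix a $\Gamma$-invariant inner product on $\mathfrak g$, hence on $V$. For $\gamma\in\Gamma$, $V^\gamma$ is the fixed subspace of $V$, $N^\gamma=(V^\gamma)^\perp\subset V$, $l(\gamma)=\dim N^\gamma$; $V=V^\gamma\oplus N^\gamma$ and $V^*=(V^\gamma)^*\oplus(N^\gamma)^*$, where $(V^\gamma)^*$ is identified with the functionals vanishing on $N^\gamma$. These decompositions induce a decomposition of $V^*\otimes\wedge^2V$ in which $(V^\gamma)^*\otimes\wedge^2N^\gamma$ is a summand. $\Gamma$ acts on families $(f_\gamma)_{\gamma\in\Gamma}$ with $f_\gamma\in V^*\otimes\wedge^\bullet V$ by $(g\cdot f)_{g\gamma g^{-1}}=g(f_\gamma)$, and $(\cdot)^\Gamma$ denotes invariants. Let $\mathsf{pr}_\gamma: S(V^* )\otimes\wedge^n V\to S((V^\gamma)^* )\otimes\wedge^{n-l(\gamma)}V^\gamma\otimes\wedge^{l(\gamma)}N^\gamma$ be the projection (restrict polynomials to $V^\gamma$, project polyvectors). With $A=S(V^* )\rtimes\Gamma$ one has $H^n(A,A)\cong\big(\bigoplus_{\gamma}S((V^\gamma)^* )\otimes\wedge^{n-l(\gamma)}V^\gamma\otimes\wedge^{l(\gamma)}N^\gamma\big)^\Gamma$. A linear Poisson structure on $A$ is an element $\Pi=(\Pi_\gamma)_\gamma$ of $(V^*\otimes\wedge^2V)^\Gamma\oplus\big(\bigoplus_{l(\gamma)=2}(V^\gamma)^*\otimes\wedge^2N^\gamma\big)^\Gamma$ (each $\Pi_\gamma$ viewed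 as an antisymmetric bilinear map $V^*\times V^*\to V^*$) whose Gerstenhaber bracket with itself in $H^3(A,A)$ vanishes, i.e. $\mathsf{pr}_\gamma([\![\Pi,\Pi]\!]_\gamma)=0$ for all $\gamma\in\Gamma$, where $$[\![\Pi,\Pi]\!]_\gamma(x,y,z)=\sum_{\alpha\beta=\gamma}\Pi_\alpha(\Pi_\beta(x,y),z+{}^\beta z)+\Pi_\alpha(\Pi_\beta(y,z),x+{}^\beta x)+\Pi_\alpha(\Pi_\beta(z,x),y+{}^\beta y),\quad x,y,z\in V^*.$$ *)

(* Defs.v *)
From HB Require Import structures.
From mathcomp Require Import all_boot all_order all_fingroup all_algebra.
From mathcomp Require Import reals.
From mathcomp Require Import sesquilinear.

Set Implicit Arguments.
Unset Strict Implicit.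
Unset Printing Implicit Defensive.

Import Order.TTheory GRing.Theory Num.Theory.
Local Open Scope ring_scope.

(* Throughout, [g] is the underlying vector space of the Lie algebra,         *)
(* [V = dualv g] is its dual, and V^* is identified with [g] by evaluation.   *)
Definition dualv (R : realType) (g : vectType R) := 'Hom(g, R^o).

Record lie_bracket (R : realType) (g : vectType R)
    (br : {bilinear g -> g -> g}) : Prop := LieBracket {
  lie_alternating : forall x, br x x = 0;
  lie_jacobi : forall x y z,
    br (br x y) z + br (br y z) x + br (br z x) y = 0
}.

Record linear_action (R : realType) (g : vectType R) (gT : finGroupType)
    (rho : gT -> 'End(g)) : Prop := LinearAction {
  lact1 : rho 1%g = \1%VF;
  lactM : forall a b, rho (a * b)%g = (rho a \o rho b)%VF
}.

Section InducedForm.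
Context (R : realType) (g : vectType R) (ip : {dot g for @idfun R}).
Local Notation V := (dualv g).

Definition pairing (x y : g) : R^o := ip x y.

Lemma pairing_linear x : linear (pairing x).
Proof. by move=> a u v; rewrite /pairing linearDr /= linearZr_LR. Qed.
HB.instance Definition _ (x : g) :=
  GRing.isLinear.Build R g R^o _ (pairing x) (pairing_linear x).

Definition flat_fun (x : g) : V := linfun (pairing x).

Lemma flat_linear : linear flat_fun.
Proof.
move=> a u v; apply/lfunP => y.
by rewrite add_lfunE scale_lfunE !lfunE /= /pairing linearDl linearZl_LR.
Qed.
HB.instance Definition _ := GRing.isLinear.Build R g V _ flat_fun flat_linear.

(* The isomorphism g -> V, x |-> <x, ->, carries the inner product of g to V. *)
Definition flat : 'Hom(g, V) := linfun flat_fun.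
Definition sharp : 'Hom(V, g) := (flat^-1)%VF.
Definition dual_form (f h : V) : R := ip (sharp f) (sharp h).

Lemma flatE x y : flat x y = ip x y.
Proof. by rewrite lfunE /= lfunE. Qed.

Lemma flat_inj : lker flat == 0%VS.
Proof.
apply/lker0P => x y /lfunP/(_ (x - y)); rewrite !flatE => E.
apply/eqP; rewrite -subr_eq0; apply/contraT => /(@neq0_dnorm_gt0 _ _ _ ip).
by rewrite linearBl /= E subrr ltxx.
Qed.

Lemma sharpK : cancel sharp flat.
Proof.
move=> f; apply: limg_lfunVK; suff -> : limg flat = fullv by exact: memvf.
apply/eqP; rewrite eqEdim subvf limg_dim_eq ?(eqP flat_inj) ?capv0 //.
by rewrite !dimvf /dim /= muln1.
Qed.

Lemma sharpE f x : ip (sharp f) x = f x.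
Proof. by rewrite -flatE sharpK. Qed.

Fact dual_form_addl h : zmod_morphism (dual_form^~ h).
Proof. by move=> f f'; rewrite /dual_form linearB linearBl. Qed.
Fact dual_form_addr f : zmod_morphism (dual_form f).
Proof. by move=> h h'; rewrite /dual_form linearB linearBr. Qed.
Fact dual_form_scalel h : scalable_for *%R (dual_form^~ h).
Proof. by move=> a f; rewrite /dual_form linearZ linearZl_LR. Qed.
Fact dual_form_scaler f : scalable_for (idfun \; *%R) (dual_form f).
Proof. by move=> a h; rewrite /dual_form linearZ linearZr_LR. Qed.
HB.instance Definition _ := isBilinear.Build R V V R *%R (idfun \; *%R)
  dual_form dual_form_addl dual_form_addr dual_form_scalel dual_form_scaler.

Fact dual_form_sym f h : dual_form f h = (-1) ^+ false * idfun (dual_form h f).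
Proof. exact: (hermC ip). Qed.
HB.instance Definition _ :=
  isHermitianSesquilinear.Build R V false idfun dual_form dual_form_sym.

Fact dual_form_gt0 f : f != 0 -> 0 < dual_form f f.
Proof.
move=> f0; apply: neq0_dnorm_gt0; apply: contraNneq f0 => sf0.
by rewrite -(sharpK f) sf0 linear0.
Qed.
HB.instance Definition _ := isDotProduct.Build R V dual_form dual_form_gt0.

End InducedForm.

Lemma dim_bigcap_lker (F : fieldType) (vT : vectType F) k
    (phi : 'I_k -> 'Hom(vT, F^o)) :
  (\dim {:vT} <= \dim (\bigcap_(i < k) lker (phi i)) + k)%N.
Proof.
elim: k phi => [|k IHk] phi; first by rewrite big_ord0 addn0.
rewrite big_ord_recr /= addnS -addSn.
apply: leq_trans (IHk (fun i => phi (widen_ord (leqnSn k) i))) _.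
rewrite leq_add2r; set U := (\bigcap_(i < k) _)%VS.
rewrite -(limg_ker_dim (phi ord_max) U) -addn1 leq_add2l.
by rewrite -[X in (_ <= X)%N](dimvf (F^o : vectType F)) dimvS ?subvf.
Qed.

Section Components.
Context (R : realType) (g : vectType R) (gT : finGroupType).
Context (rho : gT -> 'End(g)) (ip : {dot g for @idfun R}).
Local Notation V := (dualv g).

(* The contragredient action of the group on V. *)
Definition dual_act_fun (a : gT) (f : V) : V := (f \o rho a^-1%g)%VF.

Lemma dual_act_linear a : linear (dual_act_fun a).
Proof. by move=> k f h; rewrite /dual_act_fun comp_lfunDl comp_lfunZl. Qed.
HB.instance Definition _ (a : gT) :=
  GRing.isLinear.Build R V V _ (dual_act_fun a) (dual_act_linear a).

Definition dual_act (a : gT) : 'End(V) := linfun (dual_act_fun a).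

Definition Vfix (a : gT) : {vspace V} := fixedSpace (dual_act a).
Definition Nspace (a : gT) : {vspace V} := orthov (dual_form ip) (Vfix a).
Definition codim (a : gT) : nat := \dim (Nspace a).

Definition annihilator (W : {vspace V}) : {vspace g} :=
  (\bigcap_(i < \dim W) lker (vbasis W)`_i)%VS.

(* (V^a)^* and (N^a)^* inside V^* = g: the functionals on V = V^a + N^a that  *)
(* vanish on the other summand.                                               *)
Definition Vfix_dual (a : gT) : {vspace g} := annihilator (Nspace a).
Definition Nspace_dual (a : gT) : {vspace g} := annihilator (Vfix a).

Definition projF (a : gT) : 'End(g) := daddv_pi (Vfix_dual a) (Nspace_dual a).
Definition projN (a : gT) : 'End(g) := daddv_pi (Nspace_dual a) (Vfix_dual a).

(* The elementary tensor u (x) (f /\ h), as a bilinear map V^* x V^* -> V^*.  *)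
Definition elem_tensor (u : g) (f h : V) (x y : g) : g :=
  (f x * h y - f y * h x : R) *: u.

(* B belongs to U (x) /\^2 W. *)
Definition in_tensor (U : {vspace g}) (W : {vspace V}) (B : g -> g -> g) : Prop :=
  exists n (u : 'I_n -> g) (f h : 'I_n -> V),
    [/\ forall i, u i \in U, forall i, f i \in W, forall i, h i \in W
      & forall x y, B x y = \sum_(i < n) elem_tensor (u i) (f i) (h i) x y].

(* The projection of V^* (x) /\^2 V onto (V^a)^* (x) /\^2 N^a; see            *)
(* [component_elem_tensor].                                                   *)
Definition component (a : gT) (B : g -> g -> g) (x y : g) : g :=
  projF a (B (projN a x) (projN a y)).

(* The projection V^* (x) /\^n V -> (V^a)^* (x) /\^(n-l) V^a (x) /\^l N^a     *)
(* with l = codim a, where elements of V^* (x) /\^n V are seen as alternating *)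
(* n-linear maps on V^*: [S] is the set of arguments fed to N^a.  It is zero  *)
(* when l > n.                                                                *)
Definition pr (a : gT) (n : nat) (T : ('I_n -> g) -> g) (x : 'I_n -> g) : g :=
  projF a (\sum_(S : {set 'I_n} | #|S| == codim a)
             T (fun i => if i \in S then projN a (x i) else projF a (x i))).

Definition sq_bracket (Pi : gT -> g -> g -> g) (a : gT) (x y z : g) : g :=
  \sum_(p : gT * gT | (p.1 * p.2)%g == a)
    (Pi p.1 (Pi p.2 x y) (z + rho p.2 z)
     + Pi p.1 (Pi p.2 y z) (x + rho p.2 x)
     + Pi p.1 (Pi p.2 z x) (y + rho p.2 y)).

Record linear_poisson (Pi : gT -> g -> g -> g) : Prop := LinearPoisson {
  lp_id : in_tensor fullv fullv (Pi 1%g);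
  lp_codim2 : forall a, codim a = 2%N ->
    in_tensor (Vfix_dual a) (Nspace a) (Pi a);
  lp_support : forall a, a != 1%g -> codim a <> 2%N ->
    forall x y, Pi a x y = 0;
  lp_invariant : forall b a x y,
    Pi (b * a * b^-1)%g x y = rho b (Pi a (rho b^-1%g x) (rho b^-1%g y));
  lp_bracket : forall a (x : 'I_3 -> g),
    pr a (fun t : 'I_3 -> g => sq_bracket Pi a (t ord0) (t 1) (t ord_max)) x = 0
}.

(* The collection pi + \sum_(codim a = 2) c_a pi_a. *)
Definition Pi_family (br : g -> g -> g) (c : gT -> R) (a : gT) (x y : g) : g :=
  (if a == 1%g then br x y else 0)
  + (if codim a == 2%N then c a *: component a br x y else 0).

Lemma annihilatorP (W : {vspace V}) x :
  reflect {in W, forall f : V, f x = 0} (x \in annihilator W).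
Proof.
apply: (iffP subv_bigcapP) => [H f /coord_vbasis -> | H i _].
  rewrite sum_lfunE big1 // => i _.
  by have := H i isT; rewrite -memvE memv_ker scale_lfunE => /eqP ->; rewrite scaler0.
by rewrite -memvE memv_ker H // vbasis_mem ?mem_nth ?size_tuple.
Qed.

Lemma Vfix_Nspace0 a : (Nspace a :&: Vfix a = 0)%VS.
Proof.
apply/eqP; rewrite -subv0; apply/subvP => f /memv_capP[/mem_orthovP fN fV].
rewrite memv0; apply: contraT => /(@dual_form_gt0 _ _ ip).
by rewrite (fN f fV) ltxx.
Qed.

Lemma Vfix_Nspace_full a : (Nspace a + Vfix a = fullv)%VS.
Proof.
apply/eqP; rewrite eqEdim subvf dimv_disjoint_sum ?Vfix_Nspace0 //.
exact: dim_bigcap_lker.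
Qed.

Lemma Vfix_Nspace_dual0 a : (Nspace_dual a :&: Vfix_dual a = 0)%VS.
Proof.
apply/eqP; rewrite -subv0; apply/subvP => x.
move=> /memv_capP[/annihilatorP xV /annihilatorP xN]; rewrite memv0.
suff fx0 (f : V) : f x = 0.
  apply: contraT => /(@neq0_dnorm_gt0 _ _ _ ip).
  by rewrite -flatE fx0 ltxx.
have /memv_addP[f1 f1N [f2 f2V ->]] : f \in (Nspace a + Vfix a)%VS.
  by rewrite Vfix_Nspace_full memvf.
by rewrite add_lfunE xN ?xV ?addr0.
Qed.

Lemma Vfix_Nspace_dual_full a : (Nspace_dual a + Vfix_dual a = fullv)%VS.
Proof.
apply/eqP; rewrite eqEdim subvf dimv_disjoint_sum ?Vfix_Nspace_dual0 //=.
have dimE : (\dim (Nspace a) + \dim (Vfix a) = \dim {:g})%N.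
  rewrite -dimv_disjoint_sum ?Vfix_Nspace0 // Vfix_Nspace_full.
  by rewrite !dimvf /dim /= muln1.
rewrite -(leq_add2r (\dim {:g})) -{3}dimE.
rewrite [(\dim (Nspace a) + _)%N]addnC addnACA leq_add //; exact: dim_bigcap_lker.
Qed.

(* [component a] maps u (x) (f /\ h) to p(u) (x) (q(f) /\ q(h)), where p and  *)
(* q project V^* onto (V^a)^* and V onto N^a along the complementary summand. *)
Lemma component_elem_tensor a u f h x y :
  component a (elem_tensor u f h) x y =
  elem_tensor (projF a u) (daddv_pi (Nspace a) (Vfix a) f)
    (daddv_pi (Nspace a) (Vfix a) h) x y.
Proof.
have dualE (k : V) z : k (projN a z) = daddv_pi (Nspace a) (Vfix a) k z.
  have kE : daddv_pi (Nspace a) (Vfix a) k + daddv_pi (Vfix a) (Nspace a) k = k.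
    by rewrite daddv_pi_add ?Vfix_Nspace0 // Vfix_Nspace_full memvf.
  have zE : projN a z + projF a z = z.
    by rewrite daddv_pi_add ?Vfix_Nspace_dual0 // Vfix_Nspace_dual_full memvf.
  have /annihilatorP zN : projN a z \in Nspace_dual a by exact: memv_pi.
  have /annihilatorP zF : projF a z \in Vfix_dual a by exact: memv_pi.
  rewrite -{1}kE add_lfunE [X in _ + X]zN ?memv_pi // addr0.
  by rewrite -[in RHS]zE linearD /= [X in _ + X]zF ?memv_pi // addr0.
by rewrite /component /elem_tensor linearZ /= !dualE.
Qed.
End Components.

(* Main.v *)
Require Import Defs.
From mathcomp Require Import all_boot all_order all_fingroup all_algebra.
From mathcomp Require Import reals ring.
From mathcomp Require Import sesquilinear.

Set Implicit Arguments.
Unset Strict Implicit.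
Unset Printing Implicit Defensive.

Import Order.TTheory GRing.Theory Num.Theory.
Local Open Scope ring_scope.

(** Write [F a] for the fixed space of [rho a] in [g] and [N a] for its
    orthogonal complement, which is the part of [g] dual to the normal space of
    [a]; the [a]-component of the bracket is
    [pi_a (x, y) = prF [prN x, prN y]].  Only the vanishing of the projected
    self-bracket has content.  Its value at [a] is a sum, over the factorizations
    [a = b * d], of the mixed Jacobiators of [Pi b] and [Pi d], and these vanish
    for the following reasons.

    - Both factors nontrivial, with [N b] and [N d] meeting in [0].  A vector
      fixed by [b * d] is then fixed by [b] and by [d], because
      [d x - x = b^-1 x - x] lies in both normal planes.  So [b * d] has
      codimension at least 4, and no cochain of degree 3 survives the projection
      ([codim_mul]).

    - Both factors nontrivial, with [N b] and [N d] sharing a vector [w].  Here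
      the mixed Jacobiator is zero before any projection
      ([mixed_jacobiator_overlap]).  The map [prN b] sends [F d] into the
      orthogonal of [w] in the plane [N b], hence into a line, on which an
      alternating form vanishes; thus [pi_b] vanishes on [F d].  Since [pi_d]
      takes its values in [F d], only the [N d]-parts of the three arguments
      matter, and an alternating trilinear map on a plane is zero.

    - One trivial factor, [a] of codimension 2.  The projection keeps the case of
      two arguments in [N a] and one in [F a].  Bracketing with an element of
      [F a] commutes with [rho a], hence with both projections, so the terms from
      [(1, a)] and [(a, 1)] assemble into twice the Jacobi identity
      ([mixed_jacobiator_cross]).

    - Both factors trivial: this is the Jacobi identity. *)

(** * Alternating bilinear maps *)

Lemma alternating_skew (F : fieldType) (U W : lmodType F)
    (B : {bilinear U -> U -> W}) :
  (forall x, B x x = 0) -> forall x y, B x y = - B y x.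
Proof.
move=> Bxx x y; apply/eqP; rewrite -addr_eq0; apply/eqP.
by have := Bxx (x + y); rewrite linearDr !linearDl !Bxx add0r addr0 addrC.
Qed.

(** On a plane all alternating maps are multiples of one area form [d].  The cyclic
    identity for [d] says that an alternating trilinear map on a plane is zero;
    it is Cramer's rule for three vectors of a plane. *)
Lemma plane_alternating (F : fieldType) (U : vectType F) (W : lmodType F)
    (P : {vspace U}) :
  \dim P = 2%N -> exists d : U -> U -> F,
    (forall B : {bilinear U -> U -> W}, (forall x, B x x = 0) ->
       exists w, {in P &, forall x y, B x y = d x y *: w}) /\
    {in P & &, forall x y z, d x y *: z + d y z *: x + d z x *: y = 0}.
Proof.
move=> dimP; pose e i := (vbasis P)`_i.
pose X (i : nat) x : F := 
  if insub i is Some k then coord (vbasis P) (k : 'I_(\dim P)) x else 0.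
have XE x : x \in P -> x = X 0%N x *: e 0%N + X 1%N x *: e 1%N.
  move=> xP; rewrite {1}(coord_vbasis xP).
  transitivity (\sum_(i < \dim P) X i x *: e i).
    by apply: eq_bigr => i _; rewrite /X valK.
  by rewrite dimP !big_ord_recr big_ord0 /= add0r.
exists (fun x y => X 0%N x * X 1%N y - X 1%N x * X 0%N y); split.
  move=> B Bxx; exists (B (e 0%N) (e 1%N)) => x y xP yP.
  rewrite {1}(XE x xP) {1}(XE y yP).
  rewrite linearDr !linearDl !linearZl_LR !linearZr_LR !Bxx !scaler0 add0r addr0.
  rewrite [B (e 1%N) _]alternating_skew // !scalerN !scalerA addrC -scalerBl.
  by congr (_ *: _); ring.
move=> x y z xP yP zP.
move: (XE x xP) (XE y yP) (XE z zP).
move: (X 0%N x) (X 1%N x) (X 0%N y) (X 1%N y) (X 0%N z) (X 1%N z).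
move=> x0 x1 y0 y1 z0 z1 -> -> ->; rewrite !scalerDr !scalerA.
rewrite [X in X + _ = _]addrACA [LHS]addrACA -!scalerDl.
have zs v (k : F) : k = 0 -> k *: v = 0 :> U by move->; rewrite scale0r.
by rewrite !zs ?addr0 //; ring.
Qed.

(** * Fixed spaces and their orthogonal complements *)

Section FixedSpaces.
Context (R : realType) (g : vectType R) (gT : finGroupType).
Context (rho : gT -> 'End(g)) (ip : {dot g for @idfun R}).
Context (rho_action : linear_action rho).
Context (ip_invariant : forall a, isometry ip ip (rho a)).
Local Notation F := (Vfix_dual rho ip).
Local Notation N := (Nspace_dual rho).
Local Notation prF := (projF rho ip).
Local Notation prN := (projN rho ip).

Lemma lactMx a b x : rho (a * b)%g x = rho a (rho b x).
Proof. by rewrite (lactM rho_action) comp_lfunE. Qed.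

Lemma lactK a : cancel (rho a) (rho a^-1%g).
Proof. by move=> x; rewrite -lactMx mulVg (lact1 rho_action) id_lfunE. Qed.

Lemma lactVK a : cancel (rho a^-1%g) (rho a).
Proof. by move=> x; rewrite -lactMx mulgV (lact1 rho_action) id_lfunE. Qed.

(** Invariance of the inner product makes [flat] intertwine the action on [g] with
    the contragredient one, so that fixed spaces in [V] can be read off in [g]. *)
Lemma flat_dual_act a x : dual_act rho a (flat ip x) = flat ip (rho a x).
Proof.
apply/lfunP => y; rewrite lfunE /= /dual_act_fun comp_lfunE !flatE.
by rewrite -{2}(lactVK a y) ip_invariant.
Qed.

Lemma flat_Vfix a x : (flat ip x \in Vfix rho a) = (rho a x == x).
Proof.
apply/fixedSpaceP/eqP => [|xa]; last by rewrite flat_dual_act xa.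
by rewrite flat_dual_act => /(lker0P (flat_inj ip)).
Qed.

(** The functionals vanishing on the normal space are exactly the fixed vectors of
    [g]: if [flat x = n + v] with [n] normal and [v] fixed, then [<n, n> = n x]. *)
Lemma Vfix_dualP a x : reflect (rho a x = x) (x \in F a).
Proof.
apply: (iffP (annihilatorP _ _)) => [xN | xa f /mem_orthovP fN].
  have /memv_addP[n nN [v vV xE]] : flat ip x \in (Nspace rho ip a + Vfix rho a)%VS.
    by rewrite Vfix_Nspace_full memvf.
  suff n0 : n = 0 by apply/eqP; rewrite -flat_Vfix xE n0 add0r.
  apply/eqP; apply: contraT => /(@dual_form_gt0 _ _ ip).
  have /mem_orthovP nV := nN.
  rewrite -[X in dual_form _ _ X](addrK v) -xE dual_form_addr [X in _ - X]nV // subr0.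
  have -> : dual_form ip n (flat ip x) = n x.
    rewrite -(sharpE ip n x) /dual_form; congr (ip _ _).
    by apply: (lker0P (flat_inj ip)); rewrite sharpK.
  by rewrite xN // ltxx.
have xV : flat ip x \in Vfix rho a by rewrite flat_Vfix xa.
rewrite -(sharpE ip f x) -(fN _ xV) /= /dual_form; congr (ip _ _).
by apply: (lker0P (flat_inj ip)); rewrite sharpK.
Qed.

Lemma mem_Nspace_dual a x :
  reflect {in F a, forall u, ip u x = 0} (x \in N a).
Proof.
apply: (iffP (annihilatorP _ _)) => [xV u | xF f fV].
  by move=> /Vfix_dualP/eqP; rewrite -flat_Vfix => /xV; rewrite flatE.
by rewrite -(sharpE ip) xF //; apply/Vfix_dualP/eqP; rewrite -flat_Vfix sharpK.
Qed.

(** The annihilators of the two summands of [V] have at least the complementary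
    dimensions, and [g] is their direct sum, so both bounds are equalities. *)
Lemma dim_Nspace_dual a : \dim (N a) = codim rho ip a.
Proof.
have E1 : (\dim (Nspace rho ip a) + \dim (Vfix rho a) = \dim {:g})%N.
  rewrite -dimv_disjoint_sum ?Vfix_Nspace0 // Vfix_Nspace_full.
  by rewrite !dimvf /dim /= muln1.
have E2 : (\dim (N a) + \dim (F a) = \dim {:g})%N.
  by rewrite -dimv_disjoint_sum ?Vfix_Nspace_dual0 // Vfix_Nspace_dual_full.
have E3 : (\dim {:g} <= \dim (N a) + \dim (Vfix rho a))%N by exact: dim_bigcap_lker.
have E4 : (\dim {:g} <= \dim (F a) + \dim (Nspace rho ip a))%N by exact: dim_bigcap_lker.
rewrite /codim; apply/eqP; rewrite eqn_leq; apply/andP; split.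
  by rewrite -(leq_add2r (\dim (F a))) E2 addnC.
by rewrite -(leq_add2r (\dim (Vfix rho a))) E1.
Qed.

Lemma annihilator_Nspace a (f : dualv g) :
  {in F a, forall x, f x = 0} -> f \in Nspace rho ip a.
Proof.
move=> fF; apply/mem_orthovP => h hV; rewrite /= /dual_form sharpE fF //.
by apply/Vfix_dualP/eqP; rewrite -flat_Vfix sharpK.
Qed.

Lemma proj_add a x : prN a x + prF a x = x.
Proof. by rewrite daddv_pi_add ?Vfix_Nspace_dual0 // Vfix_Nspace_dual_full memvf. Qed.

(** Precomposing a fixed functional with a map commuting with [rho a] gives a fixed
    functional, so such a map preserves the common kernel of these functionals. *)
Lemma Nspace_dual_stable a (M : 'End(g)) x :
  (forall y, M (rho a y) = rho a (M y)) -> x \in N a -> M x \in N a.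
Proof.
move=> Ma /annihilatorP xN; apply/annihilatorP => f /fixedSpaceP fa.
rewrite -comp_lfunE; apply/xN/fixedSpaceP/lfunP => y.
rewrite lfunE /= /dual_act_fun !comp_lfunE -{2}fa lfunE /= /dual_act_fun comp_lfunE.
by rewrite -{2}(lactVK a y) Ma lactK.
Qed.

Lemma projF_mem a x : prF a x \in F a. Proof. exact: memv_pi. Qed.
Lemma projN_mem a x : prN a x \in N a. Proof. exact: memv_pi. Qed.

Lemma projN_id a x : x \in N a -> prN a x = x.
Proof. by apply: daddv_pi_id; exact: Vfix_Nspace_dual0. Qed.

Lemma projF_id a x : x \in F a -> prF a x = x.
Proof. by apply: daddv_pi_id; rewrite capvC; exact: Vfix_Nspace_dual0. Qed.

Local Opaque codim dimv projF projN Vfix_dual Nspace_dual.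

Lemma projN_F a x : x \in F a -> prN a x = 0.
Proof. by move=> xF; apply: (addIr (prF a x)); rewrite proj_add add0r projF_id. Qed.

Lemma projF_N a x : x \in N a -> prF a x = 0.
Proof. by move=> xN; apply: (addrI (prN a x)); rewrite proj_add addr0 projN_id. Qed.

Lemma proj_uniq a (u v : g) : u \in N a -> v \in F a ->
  prF a (u + v) = v /\ prN a (u + v) = u.
Proof.
move=> uN vF.
by rewrite !linearD /= (projF_N uN) (projF_id vF) (projN_F vF) (projN_id uN) addr0 add0r.
Qed.

Lemma proj_morph a b (M : g -> g) x :
    (forall u v : g, M (u + v) = M u + M v) ->
    {in F a, forall u, M u \in F b} -> {in N a, forall u, M u \in N b} ->
  prF b (M x) = M (prF a x) /\ prN b (M x) = M (prN a x).
Proof.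
move=> MD MF MN.
rewrite -{1 3}(proj_add a x) MD.
exact: (proj_uniq (MN _ (projN_mem a x)) (MF _ (projF_mem a x))).
Qed.

Lemma Vfix_dualJ b a x : x \in F a -> rho b x \in F (b * a * b^-1)%g.
Proof. by move=> /Vfix_dualP xa; apply/Vfix_dualP; rewrite !lactMx lactK xa. Qed.

Lemma Vfix_dualJV b a x : x \in F (b * a * b^-1)%g -> rho b^-1%g x \in F a.
Proof.
by move=> /(Vfix_dualJ b^-1%g); rewrite invgK -!mulgA mulVg mulg1 mulKg.
Qed.

Lemma Nspace_dualJ b a x : x \in N a -> rho b x \in N (b * a * b^-1)%g.
Proof.
move=> /mem_Nspace_dual xN; apply/mem_Nspace_dual => u uF.
by rewrite -(lactVK b u) ip_invariant; apply/xN/Vfix_dualJV.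
Qed.

Lemma projJ b a x :
  prF (b * a * b^-1)%g (rho b x) = rho b (prF a x) /\
  prN (b * a * b^-1)%g (rho b x) = rho b (prN a x).
Proof.
by apply: proj_morph => u; [exact: linearD | exact: Vfix_dualJ | exact: Nspace_dualJ].
Qed.

Lemma codimJ b a : codim rho ip (b * a * b^-1)%g = codim rho ip a.
Proof.
have kerL d : lker (rho d) = 0%VS by apply/eqP/lker0P/(can_inj (lactK d)).
have le d h k : (k = d * h * d^-1)%g -> (codim rho ip h <= codim rho ip k)%N.
  move=> kE; have NhE : \dim (rho d @: N h) = codim rho ip h.
    by rewrite limg_dim_eq ?kerL ?capv0 ?dim_Nspace_dual.
  rewrite -NhE; apply: leq_trans (eq_leq (dim_Nspace_dual k)); apply/dimvS.
  by apply/subvP => _ /memv_imgP[u uN ->]; rewrite kE; exact: Nspace_dualJ.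
move E : (b * a * b^-1)%g => k; apply/eqP; rewrite eqn_leq; apply/andP; split; last by apply: (le b).
by apply: (le b^-1%g); rewrite -E invgK -!mulgA mulVg mulg1 mulKg.
Qed.

Lemma codim1 : codim rho ip 1%g = 0%N.
Proof.
rewrite -dim_Nspace_dual; apply/eqP; rewrite dimv_eq0 -subv0.
apply/subvP => x /mem_Nspace_dual xN; rewrite memv0.
apply: contraT => /(@neq0_dnorm_gt0 _ _ _ ip); rewrite xN ?ltxx //.
by apply/Vfix_dualP; rewrite (lact1 rho_action) id_lfunE.
Qed.

(** If [a b x = x] then [b x - x = a^-1 x - x], and every [rho d y - y] is orthogonal
    to the fixed space of [d]; so this vector lies in [N a] and in [N b]. *)
Lemma Vfix_dual_mul a b x :
  (N a :&: N b = 0)%VS -> x \in F (a * b)%g -> x \in F a /\ x \in F b.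
Proof.
move=> ab0 /Vfix_dualP; rewrite lactMx => xab.
have moveN d y : rho d y - y \in N d.
  apply/mem_Nspace_dual => u /Vfix_dualP ud.
  by rewrite linearB /= -{1}ud ip_invariant subrr.
have bxa : rho b x = rho a^-1%g x by rewrite -[in RHS]xab lactK.
have : rho b x - x \in (N a :&: N b)%VS.
  apply/memv_capP; split; last exact: moveN.
  by rewrite -opprB memvN bxa -{1}(lactVK a x); exact: moveN.
rewrite ab0 memv0 subr_eq0 => /eqP bx; split; apply/Vfix_dualP => //.
by rewrite -{1}bx xab.
Qed.

Lemma codim_mul a b : (N a :&: N b = 0)%VS ->
  (codim rho ip a + codim rho ip b <= codim rho ip (a * b)%g)%N.
Proof.
move=> ab0; rewrite -!dim_Nspace_dual -dimv_disjoint_sum //; apply: dimvS.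
apply/subvP => _ /memv_addP[u /mem_Nspace_dual uN [v /mem_Nspace_dual vN ->]].
apply/mem_Nspace_dual => w /(Vfix_dual_mul ab0)[wa wb].
by rewrite linearD /= uN ?vN ?addr0.
Qed.

Lemma projN_orth a w x : w \in N a -> ip (prN a x) w = ip x w.
Proof.
move=> /mem_Nspace_dual wN.
by rewrite -{2}(proj_add a x) linearDl /= (wN _ (projF_mem a x)) addr0.
Qed.

End FixedSpaces.

(** Expands an alternating map in a basis.  The sum runs over all ordered pairs of
    basis vectors, whence the factor [1/2].  Composing with [P] inside and [Q]
    outside places the tensor in prescribed subspaces. *)
Lemma alternating_in_tensor (R : realType) (g : vectType R)
    (B : {bilinear g -> g -> g}) (P Q : 'End(g))
    (U : {vspace g}) (W : {vspace dualv g}) :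
    (forall x, B x x = 0) ->
    (forall f : dualv g, (f \o P)%VF \in W) ->
    (forall x, Q x \in U) ->
  in_tensor U W (fun x y => Q (B (P x) (P y))).
Proof.
move=> Bxx PW QU; pose b := vbasis {:g}; pose I : finType := 'I_(\dim {:g}).
pose f (i : I) : dualv g := (linfun (coord b i : g -> R^o) \o P)%VF.
have fE i x : f i x = coord b i (P x) by rewrite comp_lfunE lfunE.
pose u (p : I * I) := 2^-1 *: Q (B b`_p.1 b`_p.2).
exists #|{: I * I}|, (fun k => u (enum_val k)).
exists (fun k => f (enum_val k).1), (fun k => f (enum_val k).2).
split=> [k|k|k|x y]; [exact/rpredZ/QU | exact: PW | exact: PW |].
rewrite -(big_enum_val (fun p : I * I => elem_tensor (u p) (f p.1) (f p.2) x y)) /=.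
have BE v w : Q (B (P v) (P w)) =
    \sum_(p : I * I) (f p.1 v * f p.2 w) *: Q (B b`_p.1 b`_p.2).
  rewrite {1}(coord_vbasis (memvf (P v))) {1}(coord_vbasis (memvf (P w))).
  rewrite -(pair_bigA _ (fun i j => (f i v * f j w) *: Q (B b`_i b`_j))) /=.
  rewrite linear_sumlz linear_sum; apply: eq_bigr => i _.
  rewrite linear_sumr linear_sum; apply: eq_bigr => j _.
  by rewrite linearZl_LR linearZr_LR scalerA linearZ /= !fE.
have -> : Q (B (P x) (P y)) = 2^-1 *: (Q (B (P x) (P y)) - Q (B (P y) (P x))).
  rewrite [B (P y) _](alternating_skew Bxx) linearN opprK -mulr2n -scaler_nat.
  by rewrite scalerA mulVf ?scale1r ?pnatr_eq0.
rewrite !BE -sumrB scaler_sumr; apply: eq_bigr => p _.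
by rewrite /elem_tensor -scalerBl !scalerA mulrC.
Qed.

(** * Mixed Jacobiators *)

(** The contribution of one factorization of a group element to the bracket of a
    family with itself, with [t] standing for the action of the second factor. *)
Definition mixed_jacobiator (U : zmodType) (A B : U -> U -> U) (t : U -> U) x y z :=
  A (B x y) (z + t z) + A (B y z) (x + t x) + A (B z x) (y + t y).

Lemma mixed_jacobiator_rot (U : zmodType) (A B : U -> U -> U) (t : U -> U) x y z :
  mixed_jacobiator A B t x y z = mixed_jacobiator A B t y z x.
Proof. by rewrite /mixed_jacobiator -addrA addrC. Qed.

Lemma eq_mixed_jacobiator (U : zmodType) (A A' B B' : U -> U -> U) t x y z :
  A =2 A' -> B =2 B' -> mixed_jacobiator A B t x y z = mixed_jacobiator A' B' t x y z.
Proof. by move=> AE BE; rewrite /mixed_jacobiator !AE !BE. Qed.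

Lemma mixed_jacobiatorZl (K : pzRingType) (U : lmodType K) k
    (A B : U -> U -> U) t x y z :
  mixed_jacobiator (fun u v => k *: A u v) B t x y z = k *: mixed_jacobiator A B t x y z.
Proof. by rewrite /mixed_jacobiator !scalerDr. Qed.

Lemma mixed_jacobiatorZr (K : pzRingType) (U : lmodType K) k
    (A B : U -> U -> U) t x y z :
    (forall u v, A (k *: u) v = k *: A u v) ->
  mixed_jacobiator A (fun u v => k *: B u v) t x y z = k *: mixed_jacobiator A B t x y z.
Proof. by move=> AZ; rewrite /mixed_jacobiator !AZ !scalerDr. Qed.

Section Jacobiators.
Context (R : realType) (g : vectType R) (gT : finGroupType).
Context (br : {bilinear g -> g -> g}).
Context (rho : gT -> 'End(g)) (ip : {dot g for @idfun R}).
Context (br_lie : lie_bracket br) (rho_action : linear_action rho).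
Context (rho_br : forall a x y, rho a (br x y) = br (rho a x) (rho a y)).
Context (ip_invariant : forall a, isometry ip ip (rho a)).
Local Notation F := (Vfix_dual rho ip).
Local Notation N := (Nspace_dual rho).
Local Notation prF := (projF rho ip).
Local Notation prN := (projN rho ip).
Local Notation comp a := (component rho ip a br).

Let endD (L : 'End(g)) (u v : g) : L (u + v) = L u + L v :> g.
Proof. exact: linearD. Qed.
Let endZ (L : 'End(g)) k (u : g) : L (k *: u) = k *: (L u : g) :> g.
Proof. exact: linearZ. Qed.
Let end0 (L : 'End(g)) : L (0 : g) = 0 :> g.
Proof. exact: linear0. Qed.
Let brDr (x u v : g) : br x (u + v) = br x u + br x v :> g.
Proof. exact: linearDr. Qed.
Let brDl (x u v : g) : br (u + v) x = br u x + br v x :> g.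
Proof. exact: linearDl. Qed.
Let brZr k (x u : g) : br x (k *: u) = k *: br x u :> g.
Proof. exact: linearZr_LR. Qed.
Let brZl k (x u : g) : br (k *: u) x = k *: br u x :> g.
Proof. exact: linearZl_LR. Qed.

Let br0r (x : g) : br x 0 = 0 :> g.
Proof. exact: linear0r. Qed.
Let br0l (x : g) : br 0 x = 0 :> g.
Proof. exact: linear0l. Qed.
Let brI : forall x, br x x = 0 := lie_alternating br_lie.

Lemma componentDr a (x y z : g) : comp a x (y + z) = comp a x y + comp a x z.
Proof. by rewrite /component endD brDr endD. Qed.

Lemma componentZr a k (x y : g) : comp a x (k *: y) = k *: comp a x y.
Proof. by rewrite /component endZ brZr endZ. Qed.

Lemma componentZl a k (x y : g) : comp a (k *: x) y = k *: comp a x y.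
Proof. by rewrite /component endZ brZl endZ. Qed.

Lemma component0r a (x : g) : comp a x 0 = 0.
Proof. by rewrite -(scale0r (0 : g)) componentZr !scale0r. Qed.

Local Opaque codim dimv projF projN Vfix_dual Nspace_dual.

(** An automorphism that fixes [z] commutes with bracketing by [z]. *)
Lemma proj_ad a x z : z \in F a ->
  prF a (br x z) = br (prF a x) z /\ prN a (br x z) = br (prN a x) z.
Proof.
have skew := alternating_skew brI.
move=> /(Vfix_dualP rho_action ip_invariant) za.
apply: (proj_morph (M := fun u => br u z)) => [u v|u|u uN].
- by rewrite linearDl.
- move=> /(Vfix_dualP rho_action ip_invariant) ua.
  by apply/(Vfix_dualP rho_action ip_invariant); rewrite rho_br ua za.
rewrite skew memvN -(lfunE (br z)).
apply: Nspace_dual_stable uN => // y.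
by rewrite !lfunE /= rho_br za.
Qed.

(** The terms in which [z] is an argument of [pi_a] vanish, and [prF] can be pulled
    out of a bracket with [z]; what is left inside [prF] is twice the Jacobi sum. *)
Lemma mixed_jacobiator_cross a (x y z : g) :
    x \in N a -> y \in N a -> z \in F a ->
  prF a (mixed_jacobiator br (comp a) (rho a) x y z
         + mixed_jacobiator (comp a) br (rho 1%g) x y z) = 0.
Proof.
move=> xN yN zF; rewrite /mixed_jacobiator (lact1 rho_action) !id_lfunE.
have za := Vfix_dualP rho_action ip_invariant _ _ zF.
have kill u : comp a u z = 0 by rewrite /component (projN_F zF) br0r end0.
have killl u : comp a z u = 0 by rewrite /component (projN_F zF) br0l end0.
have adN u : u \in N a -> br u z \in N a.
  by move=> uN; rewrite -(projN_id ip uN) -(proj_ad u zF).2 projN_mem.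
have compN u v : u \in N a -> v \in N a -> comp a u v = prF a (br u v).
  by move=> uN vN; rewrite /component (projN_id ip uN) (projN_id ip vN).
have zxN : br z x \in N a by rewrite (alternating_skew brI) memvN adN.
rewrite kill killl !br0l !addr0 za !brDr !componentDr !kill !addr0 add0r.
rewrite !compN ?adN // -(proj_ad _ zF).1 -!endD.
have twice (p q r : g) : p + q + r = 0 -> p + p + (q + q + (r + r)) = 0.
  by move=> pqr; rewrite [q + q + _]addrACA [LHS]addrACA !addrA pqr add0r pqr.
by rewrite (twice _ _ _ (lie_jacobi br_lie x y z)) !end0.
Qed.

(** A common normal vector [w] forces [pi_a] to vanish on [F b], and then the whole
    expression depends only on the projections of [x], [y], [z] to the plane
    [N b]. *)
Lemma mixed_jacobiator_overlap a b (x y z : g) :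
    codim rho ip a = 2%N -> codim rho ip b = 2%N -> (N a :&: N b != 0)%VS ->
  mixed_jacobiator (comp a) (comp b) (rho b) x y z = 0.
Proof.
rewrite -!(dim_Nspace_dual rho ip) => Na2 Nb2 ab0.
pose w := vpick (N a :&: N b)%VS.
have w0 : w != 0 by rewrite vpick0.
have /memv_capP[wa wb] : w \in (N a :&: N b)%VS by exact: memv_pick.
have line u v : u \in F b -> v \in F b -> comp a u v = 0.
  move=> uF vF; have [d [dE d3]] := plane_alternating g Na2.
  have [e eE] := dE _ brI.
  rewrite /component eE ?projN_mem //.
  have perp s : s \in F b -> ip (prN a s) w = 0.
    move=> sF; rewrite (projN_orth rho_action ip_invariant) //.
    exact: (mem_Nspace_dual rho_action ip_invariant _ _ wb).
  (* Pairing the cyclic identity for u, v, w with w leaves d u v * <w, w> = 0. *)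
  have := d3 _ _ _ (projN_mem rho ip a u) (projN_mem rho ip a v) wa.
  move=> /(congr1 (ip^~ w)); rewrite /= linear0l !linearDl !linearZl_LR /=.
  rewrite (perp _ uF) (perp _ vF) !mulr0 !addr0 => /eqP.
  rewrite mulf_eq0 => /orP[/eqP-> | ]; first by rewrite scale0r linear0.
  by rewrite (gt_eqF (@neq0_dnorm_gt0 _ _ _ ip _ w0)).
have [d [dE d3]] := plane_alternating g Nb2.
have [e eE] := dE _ brI; pose P := prN b; pose q := prF b e.
have bE u v : comp b u v = d (P u) (P v) *: q.
  by rewrite /component eE ?projN_mem // linearZ.
(* The F b part of s is fixed by rho b and, like q, lies in F b, where pi_a is 0. *)
have termE u v s : comp a (comp b u v) (s + rho b s) =
    comp a q (d (P u) (P v) *: P s + rho b (d (P u) (P v) *: P s)).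
  rewrite bE componentZl (endZ (rho b)) -scalerDr componentZr; congr (_ *: _).
  have Fs : rho b (prF b s) = prF b s.
    exact: (Vfix_dualP rho_action ip_invariant _ _ (projF_mem _ _ _ _)).
  rewrite -{1 2}(proj_add rho ip b s) endD Fs addrACA componentDr -/P [X in _ + X]line ?addr0 //.
    exact: projF_mem.
  by rewrite memvD ?projF_mem.
rewrite /mixed_jacobiator !termE -!componentDr.
rewrite [X in X + _]addrACA [X in comp a q X]addrACA -!endD.
rewrite d3 ?projN_mem //.
by rewrite end0 addr0 component0r.
Qed.

(** * The deformed family *)

Context (c : gT -> R).
Local Notation Pi := (Pi_family rho ip br c).

Lemma Pi_family1 : Pi 1%g =2 br.
Proof.
by move=> x y; rewrite /Pi_family eqxx (codim1 rho_action ip_invariant) addr0.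
Qed.

Lemma Pi_family_codim2 a : a != 1%g -> codim rho ip a = 2%N ->
  Pi a =2 (fun x y => c a *: comp a x y).
Proof. by move=> /negPf a1 a2 x y; rewrite /Pi_family a1 a2 eqxx add0r. Qed.

Lemma Pi_family_support a : a != 1%g -> codim rho ip a <> 2%N ->
  forall x y, Pi a x y = 0.
Proof. by move=> /negPf a1 /eqP/negPf a2 x y; rewrite /Pi_family a1 a2 add0r. Qed.

Lemma Pi_family_invariant
    (c_inv : forall b a, codim rho ip a = 2%N -> c (b * a * b^-1)%g = c a) b a x y :
  Pi (b * a * b^-1)%g x y = rho b (Pi a (rho b^-1%g x) (rho b^-1%g y)).
Proof.
have aJ1 : ((b * a * b^-1)%g == 1%g) = (a == 1%g).
  by rewrite -(conjg_eq1 a b^-1%g) conjgE invgK mulgA.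
have J := projJ rho_action ip_invariant b a.
have cJ := codimJ rho_action ip_invariant b a.
have := c_inv b a; move: aJ1 J cJ; move: (b * a * b^-1)%g => k k1 J cJ ck.
have compJ : comp k x y = rho b (comp a (rho b^-1%g x) (rho b^-1%g y)).
  have {}J u := J u; have := J (rho b^-1%g x); have := J (rho b^-1%g y).
  rewrite !(lactVK rho_action) => -[_ Ny] [_ Nx].
  have [<- _] := J (br (prN a (rho b^-1%g x)) (prN a (rho b^-1%g y))).
  by rewrite rho_br -Nx -Ny.
rewrite /Pi_family k1 cJ endD; congr (_ + _).
  by case: ifP => _; [rewrite rho_br !(lactVK rho_action) | rewrite end0].
by case: eqP => [a2|_]; [rewrite endZ ck // compJ | rewrite end0].
Qed.

(** When [a] and [b] both have codimension 2, the bound on the codimension of [a * b]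
    forces their normal planes to meet. *)
Lemma mixed_jacobiator_nontrivial a b x y z :
    a != 1%g -> b != 1%g -> (codim rho ip (a * b)%g <= 3)%N ->
  mixed_jacobiator (Pi a) (Pi b) (rho b) x y z = 0.
Proof.
move=> a1 b1 ab3.
have [a2|/eqP a2] := eqVneq (codim rho ip a) 2%N; last first.
  by rewrite /mixed_jacobiator !Pi_family_support // !addr0.
have [b2|/eqP b2] := eqVneq (codim rho ip b) 2%N; last first.
  rewrite /mixed_jacobiator !(Pi_family_support b1 b2).
  by rewrite !(Pi_family_codim2 a1 a2) /component !end0 !br0l !end0 scaler0 !addr0.
rewrite (eq_mixed_jacobiator _ _ _ _ (Pi_family_codim2 a1 a2) (Pi_family_codim2 b1 b2)).
rewrite mixed_jacobiatorZl mixed_jacobiatorZr ?mixed_jacobiator_overlap ?scaler0 //.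
  apply: contraTneq ab3 => /(codim_mul rho_action ip_invariant).
  by rewrite a2 b2 -ltnNge.
by move=> u v; rewrite componentZl.
Qed.

Lemma mixed_jacobiator_bracket x y z : mixed_jacobiator br br (rho 1%g) x y z = 0.
Proof.
rewrite /mixed_jacobiator (lact1 rho_action) !id_lfunE !brDr.
by rewrite [X in X + _ = _]addrACA [LHS]addrACA (lie_jacobi br_lie) addr0.
Qed.

Lemma sq_bracketE a x y z : sq_bracket rho Pi a x y z =
  \sum_(p : gT * gT | (p.1 * p.2)%g == a)
    mixed_jacobiator (Pi p.1) (Pi p.2) (rho p.2) x y z.
Proof. by []. Qed.

Lemma sq_bracket1 x y z : sq_bracket rho Pi 1%g x y z = 0.
Proof.
rewrite sq_bracketE big1 // => -[a b] /= /eqP ab1.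
have [a1|a1] := eqVneq a 1%g.
  have -> : b = 1%g by rewrite -ab1 a1 mul1g.
  rewrite a1 (eq_mixed_jacobiator _ _ _ _ Pi_family1 Pi_family1).
  exact: mixed_jacobiator_bracket.
apply: mixed_jacobiator_nontrivial => //; last by rewrite ab1 codim1.
by apply: contra_neq a1 => b1; rewrite -ab1 b1 mulg1.
Qed.

Lemma sq_bracket_neq1 a x y z : a != 1%g -> (codim rho ip a <= 3)%N ->
  sq_bracket rho Pi a x y z =
  mixed_jacobiator br (Pi a) (rho a) x y z
  + mixed_jacobiator (Pi a) br (rho 1%g) x y z.
Proof.
move=> a1 a3; rewrite sq_bracketE (bigD1 (1%g, a)) /= ?mul1g //.
rewrite (bigD1 (a, 1%g)) /= ?mulg1 ?eqxx ?xpair_eqE ?(negPf a1) //.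
rewrite big1 => [|[b d] /= /andP[/andP[/eqP bd]]].
  rewrite addr0; congr (_ + _).
    exact: eq_mixed_jacobiator Pi_family1 (fun _ _ => erefl).
  exact: eq_mixed_jacobiator (fun _ _ => erefl) Pi_family1.
rewrite !xpair_eqE => b1 d1; apply: mixed_jacobiator_nontrivial.
- by apply: contra b1 => /eqP b1; rewrite -bd b1 mul1g !eqxx.
- by apply: contra d1 => /eqP d1; rewrite -bd d1 mulg1 !eqxx.
by rewrite bd.
Qed.

Lemma projF_sq_bracket a x y z : a != 1%g -> codim rho ip a = 2%N ->
  x \in N a -> y \in N a -> z \in F a -> prF a (sq_bracket rho Pi a x y z) = 0.
Proof.
move=> a1 a2 xN yN zF; rewrite sq_bracket_neq1 ?a2 //.
rewrite (eq_mixed_jacobiator _ _ _ _ (fun _ _ => erefl) (Pi_family_codim2 a1 a2)).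
rewrite (eq_mixed_jacobiator _ _ _ _ (Pi_family_codim2 a1 a2) (fun _ _ => erefl)).
rewrite mixed_jacobiatorZl mixed_jacobiatorZr => [|u v]; last exact: brZl.
by rewrite -scalerDr endZ mixed_jacobiator_cross ?scaler0.
Qed.

Lemma sq_bracket_rot a x y z :
  sq_bracket rho Pi a x y z = sq_bracket rho Pi a y z x.
Proof. by rewrite !sq_bracketE; apply: eq_bigr => p _; exact: mixed_jacobiator_rot. Qed.

(** In codimension 2 the set [S] of arguments projected to [N a] misses a single
    index, and cyclic invariance of the bracket moves that argument to the last
    place.  In the other codimensions up to 3 the family is zero at [a], or [a] is
    the identity. *)
Lemma pr_sq_bracket a (x : 'I_3 -> g) :
  pr rho ip a (fun t : 'I_3 -> g => sq_bracket rho Pi a (t ord0) (t 1) (t ord_max)) x = 0.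
Proof.
rewrite /pr linear_sum big1 // => S /eqP cardS.
pose t i := if i \in S then prN a (x i) else prF a (x i).
change (prF a (sq_bracket rho Pi a (t ord0) (t 1) (t ord_max)) = 0).
have [->|a1] := eqVneq a 1%g; first by rewrite sq_bracket1 end0.
have a3 : (codim rho ip a <= 3)%N by rewrite -cardS (leq_trans (max_card _)) ?card_ord.
have [a2|/eqP a2] := eqVneq (codim rho ip a) 2%N; last first.
  rewrite sq_bracket_neq1 // /mixed_jacobiator.
  by rewrite !(Pi_family_support a1 a2) !br0l !addr0 end0.
have /cards1P[i Si] : #|~: S| == 1%N by rewrite cardsCs setCK cardS a2 card_ord.
have tF : t i \in F a.
  have : i \in ~: S by rewrite Si set11.
  by rewrite inE /t => /negPf ->; exact: projF_mem.
have tN j : j != i -> t j \in N a.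
  move=> ji; have : j \notin ~: S by rewrite Si inE.
  by rewrite inE negbK /t => ->; exact: projN_mem.
have : [|| i == ord0, i == 1 | i == ord_max] by case: (i) => -[|[|[|]]].
case/or3P => /eqP iE; rewrite {}iE in tF tN *.
- by rewrite sq_bracket_rot projF_sq_bracket ?tN.
- by rewrite -sq_bracket_rot projF_sq_bracket ?tN.
by rewrite projF_sq_bracket ?tN.
Qed.

End Jacobiators.

(** * The deformed bracket is a linear Poisson structure *)

Lemma eq_in_tensor (R : realType) (g : vectType R) (U : {vspace g})
    (W : {vspace dualv g}) (B B' : g -> g -> g) :
  B =2 B' -> in_tensor U W B' -> in_tensor U W B.
Proof.
by move=> BE [n [u [f [h [uU fW hW B'E]]]]]; exists n, u, f, h; split=> // x y; rewrite BE.
Qed.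

Theorem proposition4p9 (R : realType) (g : vectType R)
  (br : {bilinear g -> g -> g}) (gT : finGroupType) (rho : gT -> 'End(g))
  (ip : {dot g for @idfun R}) (c : gT -> R)
  (br_lie : lie_bracket br)
  (rho_action : linear_action rho)
  (rho_faithful : injective rho)
  (rho_br : forall a x y, rho a (br x y) = br (rho a x) (rho a y))
  (ip_invariant : forall a, isometry ip ip (rho a))
  (c_invariant : forall b a, codim rho ip a = 2%N -> c (b * a * b^-1)%g = c a) :
  linear_poisson rho ip (Pi_family rho ip br c).
Proof.
have brI := lie_alternating br_lie.
split.
- apply: eq_in_tensor (@alternating_in_tensor _ _ br \1%VF \1%VF _ _ brI _ _).
  + by move=> x y; rewrite !id_lfunE; exact: Pi_family1.
  + by move=> f; exact: memvf.
  by move=> x; exact: memvf.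
- move=> a a2; have a1 : a != 1%g by apply: contra_eq_neq a2 => ->; rewrite codim1.
  apply: eq_in_tensor (@alternating_in_tensor _ _ br (projN rho ip a)
    (c a *: projF rho ip a) _ _ brI _ _).
  + by move=> x y; rewrite scale_lfunE; exact: Pi_family_codim2.
  + move=> f; apply: annihilator_Nspace => // x xF.
    by rewrite comp_lfunE (projN_F xF) linear0.
  by move=> x; rewrite scale_lfunE memvZ // projF_mem.
- by move=> a; exact: Pi_family_support.
- exact: Pi_family_invariant.
by move=> a x; exact: pr_sq_bracket.
Qed.
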